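(* Let $X$ and $Y$ be real Banach spaces such that $X$ or $Y$ has the approximation property. If $(x_n)_{n\in\mathbb{N}} \subset X$ converges weakly to $x \in X$, $(y_n)_{n\in\mathbb{N}}\subset Y$ converges weakly to $y \in Y$, and $(x_n\otimes y_n)_{n\in\mathbb{N}}$ is weakly convergent in $X\widehat{\otimes}_\pi Y$, then $(x_n\otimes y_n)_{n\in\mathbb{N}}$ converges weakly to $x\otimes y$ in $X\widehat{\otimes}_\pi Y$.
   Context: For real Banach spaces $X, Y$, $\mathcal{B}(X\times Y)$ is the Banach space of continuous bilinear forms on $X \times Y$ with norm $\|B\| = \sup_{x\in B_X, y\in B_Y}|B(x,y)|$, where $B_X$, $B_Y$ are the closed unit balls. For $x\in X$, $y \in Y$, the elementary tensor $x\otimes y \in \mathcal{B}(X\times Y)^*$ is given by $\langle x\otimes y, B\rangle = B(x,y)$. The projective tensor product $X\widehat{\otimes}_\pi Y$ is the norm-closed linear span of $\{x\otimes y : x\in X, y\in Y\}$ in $\mathcal{B}(X\times Y)^*$; its dual is isometrically $\mathcal{B}(X\times Y)$. A Banach space $X$ has the approximation property if for every $\varepsilon>0$ and every compact $K\subset X$ there is a bounded finite rank operator $T: X\to X$ with $\|Tx-x\|\le\varepsilon$ for all $x\in K$. *)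

(* Defs.v *)
From HB Require Import structures.
From mathcomp Require Import all_boot all_order all_algebra.
From mathcomp Require Import all_classical all_reals all_analysis.

Set Implicit Arguments.
Unset Strict Implicit.
Unset Printing Implicit Defensive.

Import Order.TTheory GRing.Theory Num.Theory.
Import numFieldNormedType.Exports.

Local Open Scope classical_set_scope.
Local Open Scope ring_scope.

Definition unit_ball (R : realType) (V : normedModType R) : set V :=
  [set v | `|v| <= 1].
Arguments unit_ball {R} V.

Lemma unit_ball0 (R : realType) (V : normedModType R) : unit_ball V 0.
Proof. by rewrite /unit_ball/= normr0 ler01. Qed.

Section sup_norm.
Context {R : realType} {I : Type} (A : set I) (a0 : I) (Aa0 : A a0).
Implicit Types f g : I -> R.

Let S f := [set `|f i| | i in A].
Let bnd f := exists M, forall i, A i -> `|f i| <= M.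

Let bndS f : bnd f -> has_ubound (S f).
Proof. by move=> [M fM]; exists M => _ [i Ai <-]; exact: fM. Qed.

Let S0 f : S f !=set0. Proof. by exists `|f a0|; exists a0. Qed.

Lemma le_sup_norm f i : bnd f -> A i -> `|f i| <= sup (S f).
Proof. by move=> bf Ai; apply: ub_le_sup; [exact: bndS|exists i]. Qed.

Lemma sup_norm_le f M : (forall i, A i -> `|f i| <= M) -> sup (S f) <= M.
Proof. by move=> fM; apply: ge_sup => // _ [i Ai <-]; exact: fM. Qed.

Lemma sup_normD f g : bnd f -> bnd g ->
  sup (S (fun i => f i + g i)) <= sup (S f) + sup (S g).
Proof.
move=> bf bg; apply: sup_norm_le => i Ai.
by rewrite (le_trans (ler_normD _ _))// lerD// le_sup_norm.
Qed.

Lemma sup_normZ k f : bnd f -> sup (S (fun i => k * f i)) = `|k| * sup (S f).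
Proof.
move=> bf; apply/eqP; rewrite eq_le; apply/andP; split.
  by apply: sup_norm_le => i Ai; rewrite normrM ler_wpM2l// le_sup_norm.
have [->|k0] := eqVneq k 0.
  rewrite normr0 mul0r; apply: le_trans (le_sup_norm _ Aa0) => //.
  by exists 0 => i Ai; rewrite mul0r normr0.
rewrite -ler_pdivlMl ?normr_gt0//; apply: sup_norm_le => i Ai.
rewrite ler_pdivlMl ?normr_gt0// -normrM.
apply: (@le_sup_norm (fun i => k * f i)) => //.
case: bf => M fM; exists (`|k| * M) => j Aj.
by rewrite normrM ler_wpM2l// fM.
Qed.

Lemma sup_norm_eq0 f i : bnd f -> sup (S f) = 0 -> A i -> f i = 0.
Proof.
by move=> bf f0 Ai; apply/eqP; rewrite -normr_le0 -f0; exact: le_sup_norm.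
Qed.

End sup_norm.

Section topological_dual.
Context {R : realType} (V : normedModType R).

Definition dual_pred : {pred V -> R} :=
  [pred f : V -> R | `[< linear_for *:%R f /\ continuous f >]].

Record dual := Dual { dual_fun :> V -> R ; dual_prop : dual_fun \in dual_pred }.

HB.instance Definition _ := [isSub for dual_fun].
HB.instance Definition _ := [Choice of dual by <:].

Lemma dual_linear (f : dual) : linear_for *:%R f.
Proof. by have /asboolP[] := dual_prop f. Qed.

Lemma dual_continuous (f : dual) : continuous f.
Proof. by have /asboolP[] := dual_prop f. Qed.

HB.instance Definition _ (f : dual) :=
  GRing.isLinear.Build R V R *:%R f (dual_linear f).

Let dual_submod_closed : submod_closed dual_pred.
Proof.
split=> [|k f g /asboolP[fl fc] /asboolP[gl gc]]; apply/asboolP.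
  split; first by move=> k x y; rewrite -[RHS]/(k * 0 + 0) mulr0 addr0.
  exact: cst_continuous.
split=> [a x y|x].
  rewrite -[LHS]/(k * f (a *: x + y) + g (a *: x + y)).
  rewrite -[RHS]/(a * (k * f x + g x) + (k * f y + g y)).
  by rewrite fl gl !mulrDr /GRing.scale/= [k * (a * _)]mulrCA addrACA.
by apply: continuousD; [apply: continuousM; [exact: cst_continuous|exact: fc]|exact: gc].
Qed.

HB.instance Definition _ := GRing.isSubmodClosed.Build R (V -> R) dual_pred
  dual_submod_closed.
HB.instance Definition _ := [SubChoice_isSubLmodule of dual by <:].

Lemma dualD (f g : dual) x : (f + g) x = f x + g x. Proof. by []. Qed.
Lemma dualZ k (f : dual) x : (k *: f) x = k * f x. Proof. by []. Qed.

Definition dual_norm (f : dual) : R := sup [set `|f x| | x in unit_ball V].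

Lemma dual_bounded (f : dual) :
  exists M, forall x, unit_ball V x -> `|f x| <= M.
Proof.
have [/(_ _) _ /(_ _)] := bounded_funP f.
move=> /(_ _ 1); apply.
by apply/linear_bounded_continuous; exact: dual_continuous.
Qed.

Let dual_normD (f g : dual) : dual_norm (f + g) <= dual_norm f + dual_norm g.
Proof. by apply: (sup_normD (unit_ball0 V)); exact: dual_bounded. Qed.

Let dual_normZ k (f : dual) : dual_norm (k *: f) = `|k| * dual_norm f.
Proof. by apply: (sup_normZ (unit_ball0 V)); exact: dual_bounded. Qed.

Let dual_norm_eq0 (f : dual) : dual_norm f = 0 -> f = 0.
Proof.
move=> f0; apply: val_inj; apply/funext => x /=.
have [->|x0] := eqVneq x 0; first by rewrite linear0.
have : f (`|x|^-1 *: x) = 0.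
  apply: (sup_norm_eq0 (dual_bounded f) f0).
  by rewrite /unit_ball/= normrZ normfV normr_id mulVf// normr_eq0.
rewrite linearZ/= => /eqP; rewrite mulf_eq0 invr_eq0 normr_eq0 (negbTE x0)/=.
by move/eqP.
Qed.

HB.instance Definition _ :=
  Lmodule_isNormed.Build R dual dual_normD dual_normZ dual_norm_eq0.

Lemma dual_normE (f : dual) : `|f| = sup [set `|f x| | x in unit_ball V].
Proof. by []. Qed.

End topological_dual.

Section continuous_bilinear_forms.
Context {R : realType} (X Y : normedModType R).

Definition cbilinear_pred : {pred X -> Y -> R} :=
  [pred B : X -> Y -> R | `[< bilinear_for *:%R *:%R B /\
                              continuous (fun p : X * Y => B p.1 p.2) >]].

Record cbilinear := CBilinear {
  cbilinear_fun :> X -> Y -> R ;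
  cbilinear_prop : cbilinear_fun \in cbilinear_pred }.

HB.instance Definition _ := [isSub for cbilinear_fun].
HB.instance Definition _ := [Choice of cbilinear by <:].

Lemma cbilinear_bilinear (B : cbilinear) : bilinear_for *:%R *:%R B.
Proof. by have /asboolP[] := cbilinear_prop B. Qed.

Lemma cbilinear_continuous (B : cbilinear) :
  continuous (fun p : X * Y => B p.1 p.2).
Proof. by have /asboolP[] := cbilinear_prop B. Qed.

HB.instance Definition _ (B : cbilinear) :=
  bilinear_isBilinear.Build R X Y R *:%R *:%R B (cbilinear_bilinear B).

Let cbilinear_submod_closed : submod_closed cbilinear_pred.
Proof.
split=> [|k f g /asboolP[[fl fr] fc] /asboolP[[gl gr] gc]]; apply/asboolP.
  split; last exact: cst_continuous.
  by split=> ? k x y; rewrite -[RHS]/(k * 0 + 0) mulr0 addr0.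
split.
  split=> [y a x x'|x a y y'].
    rewrite -[LHS]/(k * f (a *: x + x') y + g (a *: x + x') y).
    rewrite -[RHS]/(a * (k * f x y + g x y) + (k * f x' y + g x' y)).
    by rewrite (fl y) (gl y) !mulrDr /GRing.scale/= [k * (a * _)]mulrCA addrACA.
  rewrite -[LHS]/(k * f x (a *: y + y') + g x (a *: y + y')).
  rewrite -[RHS]/(a * (k * f x y + g x y) + (k * f x y' + g x y')).
  by rewrite (fr x) (gr x) !mulrDr /GRing.scale/= [k * (a * _)]mulrCA addrACA.
move=> p.
apply: (@continuousD _ _ _ (fun p => k * f p.1 p.2)); last exact: gc.
by apply: continuousM; [exact: cst_continuous|exact: fc].
Qed.

HB.instance Definition _ :=
  GRing.isSubmodClosed.Build R (X -> Y -> R) cbilinear_pred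
  cbilinear_submod_closed.
HB.instance Definition _ := [SubChoice_isSubLmodule of cbilinear by <:].

Lemma cbilinearD (B C : cbilinear) x y : (B + C) x y = B x y + C x y.
Proof. by []. Qed.
Lemma cbilinearZ k (B : cbilinear) x y : (k *: B) x y = k * B x y.
Proof. by []. Qed.

Definition cbilinear_norm (B : cbilinear) : R :=
  sup [set `|B p.1 p.2| | p in unit_ball X `*` unit_ball Y].

Lemma cbilinear_bounded (B : cbilinear) : exists M, forall p : X * Y,
  (unit_ball X `*` unit_ball Y) p -> `|B p.1 p.2| <= M.
Proof.
have [k k0 kB] := bilinear_schwarz (@cbilinear_continuous B).
exists k => -[x y] [/= x1 y1]; rewrite (le_trans (kB x y))//.
by rewrite -mulrA ler_piMr// ?(ltW k0)// mulr_ile1.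
Qed.

Let unit_ballX0 : (unit_ball X `*` unit_ball Y) (0, 0).
Proof. by split; exact: unit_ball0. Qed.

Let cbilinear_normD B C :
  cbilinear_norm (B + C) <= cbilinear_norm B + cbilinear_norm C.
Proof. by apply: (sup_normD unit_ballX0); exact: cbilinear_bounded. Qed.

Let cbilinear_normZ k B : cbilinear_norm (k *: B) = `|k| * cbilinear_norm B.
Proof. by apply: (sup_normZ unit_ballX0 k (cbilinear_bounded B)). Qed.

Lemma cbilinear_norm_bound (B : cbilinear) x y :
  `|B x y| <= cbilinear_norm B * `|x| * `|y|.
Proof.
have [->|x0] := eqVneq x 0; first by rewrite linear0l !normr0 mulr0 mul0r.
have [->|y0] := eqVneq y 0; first by rewrite linear0r !normr0 mulr0.
have : `|B (`|x|^-1 *: x) (`|y|^-1 *: y)| <= cbilinear_norm B.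
  apply: (@le_sup_norm _ _ _ _ (`|x|^-1 *: x, `|y|^-1 *: y)
    (cbilinear_bounded B)).
  by split; rewrite /unit_ball/= normrZ normfV normr_id mulVf// normr_eq0.
rewrite linearZl_LR linearZr_LR/= !normrM !normfV !normr_id.
rewrite ler_pdivrMl ?normr_gt0// ler_pdivrMl ?normr_gt0//.
by rewrite mulrC [`|x| * _]mulrC.
Qed.

Let cbilinear_norm_eq0 B : cbilinear_norm B = 0 -> B = 0.
Proof.
move=> B0; apply: val_inj; apply/funext => x; apply/funext => y /=.
apply/eqP; rewrite -normr_le0 (le_trans (cbilinear_norm_bound B x y))//.
by rewrite B0 !mul0r.
Qed.

HB.instance Definition _ := Lmodule_isNormed.Build R cbilinear
  cbilinear_normD cbilinear_normZ cbilinear_norm_eq0.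

Lemma cbilinear_normE (B : cbilinear) :
  `|B| = sup [set `|B p.1 p.2| | p in unit_ball X `*` unit_ball Y].
Proof. by []. Qed.

Definition tensor_fun (x : X) (y : Y) : cbilinear -> R := fun B => B x y.

Lemma tensor_fun_dual x y : tensor_fun x y \in @dual_pred R cbilinear.
Proof.
have tl : linear_for *:%R (tensor_fun x y) by [].
pose t : cbilinear -> R := tensor_fun x y.
pose tL := GRing.isLinear.Build R cbilinear R *:%R t tl.
pose T : {linear cbilinear -> R} := HB.pack t tL.
apply/asboolP; split => //.
apply/(@linear_bounded_continuous R cbilinear R T)/linear_boundedP.
near=> r => B; rewrite (le_trans (cbilinear_norm_bound B x y))//.
rewrite -mulrA mulrC; apply: ler_wpM2r; first exact: (normr_ge0 B).
by near: r; exact: nbhs_pinfty_ge (num_real _).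
Unshelve. all: by end_near. Qed.

Definition tensor (x : X) (y : Y) : dual cbilinear := Dual (tensor_fun_dual x y).

End continuous_bilinear_forms.

Section closed_span.
Context {R : realType} {V : normedModType R}.

Definition lin_span (A : set V) : set V :=
  [set v | exists (n : nat) (c : 'I_n -> R) (a : 'I_n -> V),
     (forall i, A (a i)) /\ v = \sum_(i < n) c i *: a i].

Variable A : set V.

Definition closed_span_pred : {pred V} := mem (closure (lin_span A)).

Record closed_span := ClosedSpan {
  closed_span_val :> V ;
  closed_span_prop : closed_span_val \in closed_span_pred }.

HB.instance Definition _ := [isSub for closed_span_val].
HB.instance Definition _ := [Choice of closed_span by <:].

Lemma sub_closed_span v : A v -> v \in closed_span_pred.
Proof.
move=> Av; apply/mem_set; apply: subset_closure.
exists 1, (fun=> 1), (fun=> v); split => //.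
by rewrite big_ord1 scale1r.
Qed.

Let lin_span0 : lin_span A 0.
Proof. by exists 0, (fun=> 0), (fun=> 0); split; [case|rewrite big_ord0]. Qed.

Let lin_spanP k u v : lin_span A u -> lin_span A v -> lin_span A (k *: u + v).
Proof.
move=> [n [c [a [Aa ->]]]] [m [d [b [Ab ->]]]].
exists (n + m)%N.
exists (fun i => match fintype.split i with inl j => k * c j | inr j => d j end).
exists (fun i => match fintype.split i with inl j => a j | inr j => b j end).
split; first by move=> i; case: fintype.split.
rewrite big_split_ord/= scaler_sumr; congr +%R; apply: eq_bigr => i _.
  by rewrite -[lshift _ _]/(unsplit (inl i)) unsplitK scalerA.
by rewrite -[rshift _ _]/(unsplit (inr i)) unsplitK.
Qed.

Let closed_span_submod_closed : submod_closed closed_span_pred.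
Proof.
split; first by apply/mem_set/subset_closure.
move=> k u v /set_mem uA /set_mem vA; apply/mem_set => W.
have cont : (fun p : V * V => k *: p.1 + p.2) @ (u, v) --> k *: u + v.
  apply: cvgD; last exact: cvg_snd.
  by apply: cvgZl_tmp; exact: cvg_fst.
move=> /cont [[/= P Q] [uP vQ] PQW].
have [u' [u'A Pu']] := uA _ uP.
have [v' [v'A Qv']] := vA _ vQ.
exists (k *: u' + v'); split; first exact: lin_spanP.
exact: (PQW (u', v')).
Qed.

HB.instance Definition _ := GRing.isSubmodClosed.Build R V closed_span_pred
  closed_span_submod_closed.
HB.instance Definition _ := [SubChoice_isSubLmodule of closed_span by <:].

Definition closed_span_norm (u : closed_span) : R := `|closed_span_val u|.

Let closed_span_normD u v :
  closed_span_norm (u + v) <= closed_span_norm u + closed_span_norm v.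
Proof. exact: ler_normD. Qed.

Let closed_span_normZ k u :
  closed_span_norm (k *: u) = `|k| * closed_span_norm u.
Proof. exact: normrZ. Qed.

Let closed_span_norm_eq0 u : closed_span_norm u = 0 -> u = 0.
Proof. by move=> /normr0_eq0 u0; exact: val_inj. Qed.

HB.instance Definition _ := Lmodule_isNormed.Build R closed_span
  closed_span_normD closed_span_normZ closed_span_norm_eq0.

Lemma closed_span_normE (u : closed_span) : `|u| = `|closed_span_val u|.
Proof. by []. Qed.

End closed_span.

Arguments closed_span {R V} A.

Section projective_tensor_product.
Context {R : realType} (X Y : normedModType R).

Definition elementary_tensors : set (dual (cbilinear X Y)) :=
  [set tensor x y | x in setT & y in setT].

Definition proj_tensor := closed_span elementary_tensors.

Lemma tensor_proj (x : X) (y : Y) :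
  tensor x y \in closed_span_pred elementary_tensors.
Proof. by apply: sub_closed_span; exists x => //; exists y. Qed.

Definition ptensor (x : X) (y : Y) : proj_tensor := ClosedSpan (tensor_proj x y).

Lemma ptensorE x y (B : cbilinear X Y) :
  closed_span_val (ptensor x y) B = B x y.
Proof. by []. Qed.

End projective_tensor_product.

Definition weakly_cvg (R : realType) (V : normedModType R)
    (u : nat -> V) (l : V) :=
  forall f : dual V, f (u n) @[n --> \oo] --> f l.

Definition bounded_operator (R : realType) (V W : normedModType R)
    (T : {linear V -> W}) :=
  exists M : R, forall v, `|T v| <= M * `|v|.

Definition finite_rank (R : realType) (V W : normedModType R)
    (T : {linear V -> W}) :=
  exists e : seq W, range T `<=` lin_span [set` e].

Definition approximation_property (R : realType) (X : normedModType R) :=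
  forall (eps : R) (K : set X), 0 < eps -> compact K ->
    exists T : {linear X -> X},
      [/\ bounded_operator T, finite_rank T &
          forall x, K x -> `|T x - x| <= eps].

(* Main.v *)
Require Import Defs.
From HB Require Import structures.
From mathcomp Require Import all_boot all_order all_algebra.
From mathcomp Require Import all_classical all_reals all_analysis.
From mathcomp Require Import ring lra.

(** Let [u] be the weak limit of the [x_n (x) y_n]. Testing against the product
[f (x) g] of two functionals gives [u (f (x) g) = lim f (x_n) g (y_n) = f x g y], so
[w = u - x (x) y] vanishes on all products of functionals, and it remains to see that
this forces [w = 0]. This is where the approximation property enters
([proj_tensor_eq0]).

The element [w] is the sum of a series of [c *: (a (x) b)] with [a] and [b] in the
unit balls and absolutely summable coefficients [c] ([nuclear_representation]).
The coefficients can even be grouped into blocks whose sums decay like [4^-k], so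
that a factor [2^-k] can be moved to the vectors [a], which then form a compact set.
Let [T] be an operator of finite rank that is close to the identity on it. For a
bilinear form [B], the form [B (T x) y] is a finite sum of products of functionals,
on which [w] vanishes, and [w] is small on [B x y - B (T x) y], term by term. Hence
[w B = 0] ([approximation_property_pairing_eq0]).

Such a series exists because a finite sum of elementary tensors that is close to [w]
can be chosen with coefficients of total size close to the norm of [w]
([atomic_approximation]). As the norm is that of the dual of the space of bilinear
forms, this is a duality statement: a functional that is dominated by the
projective norm is a bilinear form of norm at most 1 ([atomic_gauge_le_norm]). It
rests on the Hahn-Banach theorem, which also gives the continuity of the coordinate
functionals of an operator of finite rank ([finite_rank_expansion]). *)

Set Implicit Arguments.
Unset Strict Implicit.
Unset Printing Implicit Defensive.

Import Order.TTheory GRing.Theory Num.Theory.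
Import numFieldNormedType.Exports.

Local Open Scope classical_set_scope.
Local Open Scope ring_scope.

(** * The Hahn-Banach theorem *)

Section hahn_banach.
Context {R : realType} {V : lmodType R}.
Implicit Types (p q : V -> R) (a u v x : V).

Definition sublinear p :=
  (forall u v, p (u + v) <= p u + p v) /\
  (forall k v, 0 < k -> p (k *: v) <= k * p v).

Lemma sublinear0 p : sublinear p -> p 0 = 0.
Proof.
move=> [_ pZ]; have := pZ 2^-1 0 ltac:(lra); have := pZ 2 0 ltac:(lra).
rewrite !scaler0; lra.
Qed.

Lemma sublinearZ p k v : sublinear p -> 0 <= k -> p (k *: v) = k * p v.
Proof.
move=> sp; rewrite le_eqVlt => /predU1P[<-|k0].
  by rewrite scale0r mul0r sublinear0.
apply/eqP; rewrite eq_le sp.2//= -ler_pdivlMl//.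
by rewrite -[leLHS](_ : p (k^-1 *: (k *: v)) = _) ?sp.2 ?invr_gt0// scalerK ?gt_eqF.
Qed.

Lemma sublinear_ge_opp p v : sublinear p -> - p (- v) <= p v.
Proof.
by move=> sp; have := sp.1 v (- v); rewrite subrr sublinear0//; lra.
Qed.

(** The two places where sublinearity passes to a pointwise infimum, chains of
sublinear functionals and [slope_shift], have in common that the indices combine:
each pair of indices is beaten by a single one on sums. *)
Lemma sublinear_inf (I : Type) (D : set I) (F : I -> V -> R) (m : V -> R) :
    D !=set0 -> (forall i v, D i -> m v <= F i v) ->
    (forall i j u v, D i -> D j ->
       exists2 l, D l & F l (u + v) <= F i u + F j v) ->
    (forall i k v, D i -> 0 < k -> exists2 l, D l & F l (k *: v) <= k * F i v) ->
  sublinear (fun v => inf [set F i v | i in D]).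
Proof.
move=> [i0 Di0] mF FD FZ.
have hl v : has_lbound [set F i v | i in D].
  by exists (m v) => _ [i Di <-]; exact: mF.
have hn v : [set F i v | i in D] !=set0 by exists (F i0 v), i0.
have le1 v i : D i -> inf [set F i v | i in D] <= F i v.
  by move=> Di; apply: ge_inf => //; exists i.
split=> [u v|k v k0].
  rewrite -lerBlDr; apply: lb_le_inf => // _ [i Di <-].
  rewrite lerBlDr -lerBlDl; apply: lb_le_inf => // _ [j Dj <-].
  rewrite lerBlDl; have [l Dl] := FD i j u v Di Dj.
  exact/le_trans/le1.
rewrite -ler_pdivrMl//; apply: lb_le_inf => // _ [i Di <-].
rewrite ler_pdivrMl//; have [l Dl] := FZ i k v Di k0.
exact/le_trans/le1.
Qed.

(** The best lower estimate of the slope of [q] in the direction [a]: it stays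
sublinear and below [q], and it is at most [q (x + a) - q a], which is what forces
a minimal sublinear functional to be superadditive. *)
Definition slope_shift q a : V -> R :=
  fun x => inf [set q (x + t *: a) - t * q a | t in [set t | 0 <= t]].

Let lb_shift q a (t : R) x : sublinear q -> 0 <= t ->
  - q (- x) <= q (x + t *: a) - t * q a.
Proof.
move=> sq t0; have := sq.1 (x + t *: a) (- x).
by rewrite addrAC subrr add0r (sublinearZ _ sq t0); lra.
Qed.

Lemma slope_shift_sublinear q a : sublinear q -> sublinear (slope_shift q a).
Proof.
move=> sq; apply: (@sublinear_inf _ _ _ (fun x => - q (- x))).
- by exists 0 => /=.
- by move=> t x t0; exact: lb_shift.
- move=> s t u v /= s0 t0; exists (s + t) => /=; first exact: addr_ge0.
  rewrite scalerDl addrACA mulrDl.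
  by have := sq.1 (u + s *: a) (v + t *: a); lra.
- move=> t k v /= t0 k0; exists (k * t) => /=; first by rewrite mulr_ge0// ltW.
  rewrite -scalerA -scalerDr mulrBr mulrA lerD2r; exact: sq.2.
Qed.

Lemma slope_shift_le q a t x : sublinear q -> 0 <= t ->
  slope_shift q a x <= q (x + t *: a) - t * q a.
Proof.
move=> sq t0; apply: ge_inf; last by exists t.
by exists (- q (- x)) => _ [s s0 <-]; exact: lb_shift.
Qed.

(** Zorn's lemma for the reversed pointwise order. The infimum over a chain exists
since every sublinear functional below [p] is at least [- p (- v)] at [v]. *)
Lemma exists_minimal_sublinear p : sublinear p -> exists q,
  [/\ sublinear q, forall v, q v <= p v &
      forall r, sublinear r -> (forall v, r v <= q v) -> r = q].
Proof.
move=> sp; pose T := {q | sublinear q /\ forall v, q v <= p v}.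
pose rel (q r : T) := `[< forall v, sval r v <= sval q v >].
have [||||[q [sq qp]] qmin] := @Zorn T rel.
- by move=> q; apply/asboolP.
- move=> q r s /asboolP qr /asboolP rs; apply/asboolP => v.
  exact: le_trans (qr v).
- move=> [q qP] [r rP] /asboolP/= qr /asboolP/= rq; apply: eq_exist.
  by apply/funext => v; apply/eqP; rewrite eq_le qr rq.
- move=> A Atot; have [[q0 Aq0]|A0] := pselect (A !=set0); last first.
    exists (exist _ p (conj sp (fun=> lexx _))) => s As; case: A0; by exists s.
  pose F (q : T) := sval q.
  have bF (q : T) v : A q -> - p (- v) <= F q v.
    move=> _; case: q => q [sq qp] /=.
    by have := sublinear_ge_opp v sq; have := qp (- v); lra.
  have lb v : has_lbound [set F q v | q in A].
    by exists (- p (- v)) => _ [q Aq <-]; exact: bF.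
  have s_inf : sublinear (fun v => inf [set F q v | q in A]).
    apply: (@sublinear_inf _ _ F (fun v => - p (- v))).
    + by exists q0.
    + by move=> q v; exact: bF.
    + move=> q r u v Aq Ar; have [/asboolP qr|/asboolP rq] := Atot _ _ Aq Ar.
        by exists r => //; have := (svalP r).1.1 u v; have := qr u; rewrite /F; lra.
      by exists q => //; have := (svalP q).1.1 u v; have := rq v; rewrite /F; lra.
    + by move=> q k v Aq k0; exists q => //; exact: (svalP q).1.2.
  have inf_le (q : T) v : A q -> inf [set F q v | q in A] <= F q v.
    by move=> Aq; apply: ge_inf => //; exists q.
  have inf_p v : inf [set F q v | q in A] <= p v.
    by apply: le_trans (inf_le _ v Aq0) _; exact: (svalP q0).2.
  exists (exist (fun r : V -> R => sublinear r /\ forall v, r v <= p v)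
    _ (conj s_inf inf_p)).
  move=> q Aq.
  by apply/asboolP => v; exact: inf_le.
exists q; split=> // r sr rq.
have rp v : r v <= p v by exact: le_trans (qp v).
have := qmin (exist (fun r : V -> R => sublinear r /\ forall v, r v <= p v)
  r (conj sr rp)).
by move=> /(_ (introT (asboolP _) rq)) [].
Qed.

(** A minimal sublinear functional [f] equals each of its slope shifts, hence is
additive. Starting from the slope shift of [p] in the direction [v0] rather than
from [p] itself makes [f (- v0) <= - p v0], and so [f v0 = p v0]. *)
Theorem hahn_banach p v0 : sublinear p ->
  exists f : V -> R, [/\ linear_for *:%R f, f v0 = p v0 & forall v, f v <= p v].
Proof.
move=> sp; have [f [sf fp fmin]] :=
  exists_minimal_sublinear (slope_shift_sublinear v0 sp).
have shift_self q a v : sublinear q -> slope_shift q a v <= q v.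
  by move=> sq; have := slope_shift_le a v sq (lexx 0);
     rewrite scale0r addr0 mul0r subr0.
have fD u v : f (u + v) = f u + f v.
  apply/eqP; rewrite eq_le sf.1/= -lerBrDr.
  have fe : slope_shift f v = f.
    apply: fmin; first exact: slope_shift_sublinear.
    by move=> x; exact: shift_self.
  rewrite -[X in X <= _]/(f u) -{1}fe.
  by have := slope_shift_le v u sf ler01; rewrite scale1r mul1r.
have fN v : f (- v) = - f v.
  by have := fD v (- v); rewrite subrr sublinear0//; lra.
exists f; split.
- move=> k u v; rewrite fD; congr (_ + _); rewrite -[RHS]/(k * f u).
  have [k0|/ltW k0] := leP 0 k; first exact: sublinearZ.
  by rewrite -[k]opprK scaleNr fN mulNr sublinearZ// oppr_ge0.
- apply/eqP; rewrite eq_le (le_trans (fp _) (shift_self _ _ _ sp))/=.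
  have := fp (- v0); have := slope_shift_le v0 (- v0) sp ler01.
  by rewrite scale1r addNr sublinear0// fN; lra.
- by move=> v; exact: le_trans (fp v) (shift_self _ _ _ sp).
Qed.

End hahn_banach.

(** * Bounded functionals, bilinear forms and operators of finite rank *)

Section bounded_maps.
Context {R : realType}.
Implicit Types V W X Y : normedModType R.

Lemma dual_of_bounded V (f : V -> R) (M : R) :
    linear_for *:%R f -> (forall v, `|f v| <= M * `|v|) ->
  exists g : dual V, forall v, g v = f v.
Proof.
move=> fl fM.
pose fL := GRing.isLinear.Build R V R *:%R f fl.
pose F : {linear V -> R} := HB.pack f fL.
have fP : f \in @dual_pred R V.
  apply/asboolP; split=> //.
  apply/(@linear_bounded_continuous R V R F)/bounded_funP => r.
  exists (`|M| * `|r|) => v vr; apply: le_trans (fM v) _.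
  apply: le_trans (ler_wpM2r (normr_ge0 v) (ler_norm M)) _.
  by rewrite ler_wpM2l// (le_trans vr)// ler_norm.
by exists (Dual fP).
Qed.

Lemma dual_norm_bound V (f : dual V) v : `|f v| <= `|f| * `|v|.
Proof.
have [->|v0] := eqVneq v 0; first by rewrite linear0 !normr0 mulr0.
have : `|f (`|v|^-1 *: v)| <= `|f|.
  apply: (le_sup_norm (dual_bounded f)).
  by rewrite /unit_ball/= normrZ normfV normr_id mulVf// normr_eq0.
rewrite linearZ/= normrM normfV normr_id.
by rewrite ler_pdivrMl ?normr_gt0// mulrC.
Qed.

Lemma cbilinear_of_bounded X Y (B : X -> Y -> R) (M : R) :
    bilinear_for *:%R *:%R B -> (forall x y, `|B x y| <= M * `|x| * `|y|) ->
  exists C : cbilinear X Y, forall x y, C x y = B x y.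
Proof.
move=> bB BM.
pose BL := bilinear_isBilinear.Build R X Y R *:%R *:%R B bB.
pose F : {bilinear X -> Y -> R} := HB.pack B BL.
have BP : B \in @cbilinear_pred R X Y.
  apply/asboolP; split=> // -[a b].
  (* what the bound M gives for |B p.1 p.2 - B a b|, one argument at a time *)
  pose h (p : X * Y) : R := M * `|p.1 - a| * `|p.2| + M * `|a| * `|p.2 - b|.
  have h0 : h p @[p --> (a, b)] --> 0.
    have <- : h (a, b) = 0 by rewrite /h/= !subrr !normr0 !(mulr0, mul0r) addr0.
    have c1 : {for (a, b), continuous (fun p : X * Y => p.1)} by exact: cvg_fst.
    have c2 : {for (a, b), continuous (fun p : X * Y => p.2)} by exact: cvg_snd.
    apply: cvgD; apply: cvgM.
    - apply: cvgM; first exact: cvg_cst.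
      by apply: cvg_norm; apply: cvgB => //; exact: cvg_cst.
    - exact: cvg_norm.
    - exact: cvg_cst.
    - by apply: cvg_norm; apply: cvgB => //; exact: cvg_cst.
  apply/subr_cvg0; apply/norm_cvg0P.
  apply: (@squeeze_cvgr _ _ _ _ (cst 0) h) => //; last exact: cvg_cst.
  near=> p => /=; rewrite normr_ge0/=.
  have -> : B p.1 p.2 - B a b = F (p.1 - a) p.2 + F a (p.2 - b).
    by rewrite linearBl linearBr/= addrA subrK.
  by rewrite (le_trans (ler_normD _ _))// lerD//; exact: BM.
by exists (CBilinear BP).
Unshelve. all: by end_near. Qed.

Lemma cbilinear_le X Y (B : cbilinear X Y) x y : `|B x y| <= `|B| * `|x| * `|y|.
Proof. exact: cbilinear_norm_bound. Qed.

Lemma cbilinear_norm_le X Y (B : cbilinear X Y) (M : R) :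
    (forall x y, `|x| <= 1 -> `|y| <= 1 -> `|B x y| <= M) -> `|B| <= M.
Proof.
move=> BM; apply: (@sup_norm_le _ _ _ (0, 0)).
  by split; exact: unit_ball0.
by move=> [x y] [/= x1 y1]; exact: BM.
Qed.

Lemma dual_norm_le V (f : dual V) (M : R) :
    (forall v, `|v| <= 1 -> `|f v| <= M) -> `|f| <= M.
Proof. by move=> fM; apply: (@sup_norm_le _ _ _ 0) => //; exact: unit_ball0. Qed.

(** The conclusion is arranged so as to cover [v = 0] as well: in all cases
[u |-> u - g u *: v] is a bounded projection that kills [v]. *)
Lemma norming_functional V (v : V) : exists g : dual V, g v *: v = v.
Proof.
have norm_sub : sublinear (fun u : V => `|u|).
  split; first exact: ler_normD.
  by move=> k u k0; rewrite normrZ gtr0_norm.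
have [f [fl fv f_le]] := hahn_banach v norm_sub.
have fN u : - f u = f (- u).
  have f0 : f 0 = 0.
    by have := fl 1 0 0; rewrite scaler0 addr0 /GRing.scale/= mul1r; lra.
  have := fl (-1) u 0; rewrite addr0 f0 addr0 scaleN1r /GRing.scale/= => ->.
  by rewrite mulN1r.
have f_bd u : `|f u| <= 1 * `|u|.
  by rewrite mul1r ler_norml f_le lerNl fN -normrN f_le.
have [g gE] := dual_of_bounded fl f_bd.
have [->|v0] := eqVneq v 0; first by exists g; rewrite scaler0.
exists (`|v|^-1 *: g).
by rewrite dualZ gE fv mulVf ?scale1r// normr_eq0.
Qed.

(** Induction on the number of vectors that span the range: split off the rank-one
operator [g (T _) *: w], where the norming functional [g] of the first vector [w]
makes the remainder live in the span of the projections of the other vectors. The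
vector [0] is added to the list because the projection sends [w] there. *)
Lemma finite_rank_expansion V W (e : seq W) (T : V -> W) (M : R) :
    linear T -> (forall v, `|T v| <= M * `|v|) ->
    (forall v, lin_span [set` 0 :: e] (T v)) ->
  exists l : seq (dual V * W), forall v, T v = \sum_(i <- l) i.1 v *: i.2.
Proof.
move En : (size e) => n; elim: n e En T M => [|n IH] [|w e]//= En T M Tl TM Te.
  exists [::] => v; rewrite big_nil; have [m [c [a [ae ->]]]] := Te v.
  apply: big1 => i _; have := ae i; rewrite /= inE => /eqP ->; exact: scaler0.
have [g gw] := norming_functional w.
pose P u : W := u - g u *: w.
have Pl : linear P.
  move=> k u v; rewrite /P linearP/= scalerDl scalerBr scalerA.
  by rewrite opprD addrACA.
have [f fE] : exists f : dual V, forall v, f v = g (T v).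
  apply: (@dual_of_bounded _ _ (`|g| * M)).
    by move=> k u v; rewrite Tl linearP.
  move=> v; apply: le_trans (dual_norm_bound g _) _.
  by rewrite -mulrA ler_wpM2l.
have [||v|v|l lE] := IH (map P e) _ (fun v => P (T v)) (M + `|f| * `|w|).
- by rewrite size_map; case: En.
- by move=> k u v; rewrite Tl Pl.
- rewrite /P -fE (le_trans (ler_normB _ _))// mulrDl lerD// normrZ.
  by rewrite mulrAC ler_wpM2r// dual_norm_bound.
- have [m [c [a [ae TvE]]]] := Te v.
  pose PL := GRing.isLinear.Build R W W *:%R P Pl.
  pose F : {linear W -> W} := HB.pack P PL.
  exists m, c, (P \o a); split=> [i/=|].
    have := ae i; rewrite /= !inE => /or3P[/eqP->|/eqP->|aie].
    + by rewrite /P linear0 scale0r subr0 eqxx.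
    + by rewrite /P gw subrr eqxx.
    + by rewrite map_f ?orbT.
  rewrite -[P]/(F : W -> W) TvE linear_sum.
  by apply: eq_bigr => i _; rewrite linearZ.
exists ((f, w) :: l) => v; rewrite big_cons/= -lE /P fE addrC subrK//.
Qed.

End bounded_maps.

(** * Finite sums of elementary tensors and the projective norm *)

Section atoms.
Context {R : realType} {X Y : normedModType R}.
Implicit Types (l : seq (R * (X * Y))) (t w : proj_tensor X Y).

(** A list of triples [(c, (x, y))] stands for the finite sum of the
[c *: (x (x) y)]; keeping [x] and [y] in the unit balls makes [cost] an upper bound
for the projective norm, and lets concatenation play the role of addition. *)
Definition unit_atoms l :=
  all (fun i => (`|i.2.1| <= 1) && (`|i.2.2| <= 1)) l.

Definition cost l : R := \sum_(i <- l) `|i.1|.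

Definition pairing l (B : X -> Y -> R) : R := \sum_(i <- l) i.1 * B i.2.1 i.2.2.

Definition tensor_sum l : proj_tensor X Y :=
  \sum_(i <- l) i.1 *: ptensor i.2.1 i.2.2.

Lemma proj_tensorP t w :
  (forall B : cbilinear X Y, closed_span_val t B = closed_span_val w B) -> t = w.
Proof. by move=> tw; do 2 apply: val_inj; apply/funext. Qed.

Lemma tensor_sumE l (B : cbilinear X Y) :
  closed_span_val (tensor_sum l) B = pairing l B.
Proof.
rewrite /tensor_sum /pairing; elim: l => [|i l IH]; first by rewrite !big_nil.
by rewrite !big_cons -IH.
Qed.

Lemma proj_tensor_bound t (B : cbilinear X Y) :
  `|closed_span_val t B| <= `|t| * `|B|.
Proof. exact: dual_norm_bound. Qed.

Lemma norm_ptensor_le (x : X) (y : Y) : `|ptensor x y| <= `|x| * `|y|.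
Proof.
apply: dual_norm_le => B B1; rewrite (le_trans (cbilinear_norm_bound B x y))//.
by rewrite -mulrA ler_piMl ?mulr_ge0.
Qed.

Lemma ptensor_bilinear :
  bilinear_for *:%R *:%R (@ptensor R X Y).
Proof.
split=> [y k x x'|x k y y']; apply: proj_tensorP => B.
  by rewrite -[LHS]/(B (k *: x + x') y) linearPl.
by rewrite -[LHS]/(B x (k *: y + y')) linearPr.
Qed.

Lemma tensor_sum_cat l1 l2 :
  tensor_sum (l1 ++ l2) = tensor_sum l1 + tensor_sum l2.
Proof. exact: big_cat. Qed.

Definition scale_atoms k l := [seq (k * i.1, i.2) | i <- l].

Lemma tensor_sum_scale k l : tensor_sum (scale_atoms k l) = k *: tensor_sum l.
Proof.
rewrite /tensor_sum big_map scaler_sumr.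
by apply: eq_bigr => i _; rewrite scalerA.
Qed.

Lemma cost_scale k l : cost (scale_atoms k l) = `|k| * cost l.
Proof.
by rewrite /cost big_map mulr_sumr; apply: eq_bigr => i _; rewrite normrM.
Qed.

Lemma unit_atoms_scale k l : unit_atoms (scale_atoms k l) = unit_atoms l.
Proof. exact: all_map. Qed.

Lemma norm_normalize_le1 (V : normedModType R) (v : V) : `| `|v|^-1 *: v | <= 1.
Proof.
have [->|v0] := eqVneq v 0; first by rewrite scaler0 normr0.
by rewrite normrZ normfV normr_id mulVf// normr_eq0.
Qed.

Lemma unit_atom (c : R) (x : X) (y : Y) : exists l,
  unit_atoms l /\ tensor_sum l = c *: ptensor x y.
Proof.
exists [:: (c * `|x| * `|y|, (`|x|^-1 *: x, `|y|^-1 *: y))]; split.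
  by rewrite /= !norm_normalize_le1.
rewrite /tensor_sum big_seq1/=; apply: proj_tensorP => B.
rewrite -[LHS]/(c * `|x| * `|y| * B (`|x|^-1 *: x) (`|y|^-1 *: y)).
have -> : B (`|x|^-1 *: x) (`|y|^-1 *: y) = `|x|^-1 * (`|y|^-1 * B x y).
  by rewrite linearZl_LR linearZr_LR.
rewrite -[RHS]/(c * B x y).
have [x0|x0] := eqVneq x 0; first by rewrite x0 linear0l !mulr0.
have [y0|y0] := eqVneq y 0; first by rewrite y0 linear0r !mulr0.
by field; rewrite !normr_eq0 x0 y0.
Qed.

Lemma tensor_sum_dense t (e : R) : 0 < e ->
  exists2 l, unit_atoms l & `|t - tensor_sum l| < e.
Proof.
move=> e0; have [v []] :=
  set_mem (closed_span_prop t) _ (nbhsx_ballx (closed_span_val t) e e0).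
move=> [n [c [a [aE ->]]]] tv.
suff [l ul lE] : exists2 l, unit_atoms l &
    closed_span_val (tensor_sum l) = \sum_(i < n) c i *: a i.
  by exists l => //; move: tv; rewrite -lE -ball_normE.
elim: (index_enum _) => [|i s [l ul lE]].
  by exists [::] => //; rewrite /tensor_sum !big_nil.
have [x _ [y _ xyE]] := aE i; have [l' [ul' l'E]] := unit_atom (c i) x y.
exists (l' ++ l); first by rewrite /unit_atoms all_cat; apply/andP.
by rewrite big_cons -lE tensor_sum_cat l'E -xyE.
Qed.

(** The projective norm relaxed by an error term: [t] need not be a finite sum, its
distance to one is charged at the rate [M]. So the gauge lives on the whole space
and is [M]-Lipschitz, and the functionals that it dominates are continuous. *)
Definition atomic_gauge (M : R) t : R :=
  inf [set cost l + M * `|t - tensor_sum l| | l in unit_atoms].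

Lemma cost_ge0 l : 0 <= cost l.
Proof. exact: sumr_ge0. Qed.

Lemma atomic_gauge_le M t l : 0 <= M -> unit_atoms l ->
  atomic_gauge M t <= cost l + M * `|t - tensor_sum l|.
Proof.
move=> M0 ul; apply: ge_inf; last by exists l.
by exists 0 => _ [s _ <-]; rewrite addr_ge0 ?cost_ge0 ?mulr_ge0.
Qed.

Lemma atomic_gauge_sublinear M : 0 <= M -> sublinear (atomic_gauge M).
Proof.
move=> M0; apply: (@sublinear_inf _ _ _ _ _ (fun=> 0)).
- by exists [::].
- by move=> l t _; rewrite addr_ge0 ?cost_ge0 ?mulr_ge0.
- move=> l1 l2 t w ul1 ul2; exists (l1 ++ l2).
    by rewrite /unit_atoms/= all_cat; apply/andP.
  rewrite /cost big_cat/= tensor_sum_cat addrACA lerD2l -mulrDr ler_wpM2l//.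
  by rewrite opprD addrACA ler_normD.
- move=> l k t ul k0; exists (scale_atoms k l); first by rewrite /= unit_atoms_scale.
  rewrite cost_scale tensor_sum_scale -scalerBr normrZ gtr0_norm//.
  by rewrite mulrDr mulrCA.
Qed.

(** Duality between the projective norm and bilinear forms. A functional [F] that is
dominated by the gauge and attains it at [t] restricts to elementary tensors as a
bilinear form [B0] of norm at most 1. Both [F] and the evaluation at [B0] are
continuous, and they agree on finite sums, which are dense; hence the gauge of [t]
is the value of [t] at [B0], which is at most the norm of [t]. *)
Lemma atomic_gauge_le_norm M t : 0 <= M -> atomic_gauge M t <= `|t|.
Proof.
move=> M0; have [f [fl ft f_le]] := hahn_banach t (atomic_gauge_sublinear M0).
pose fL := GRing.isLinear.Build R (proj_tensor X Y) R *:%R f fl.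
pose F : {linear proj_tensor X Y -> R} := HB.pack f fL.
have FM s : `|F s| <= M * `|s|.
  have F_le r : F r <= M * `|r|.
    apply: le_trans (f_le r) _.
    apply: le_trans (@atomic_gauge_le M r [::] M0 _) _ => //.
    by rewrite /cost /tensor_sum !big_nil subr0 add0r.
  by rewrite ler_norml F_le lerNl -linearN -normrN F_le.
have F1 (x : X) (y : Y) : `|x| <= 1 -> `|y| <= 1 -> `|F (ptensor x y)| <= 1.
  move=> x1 y1.
  have F_le (c : R) : `|c| <= 1 -> F (c *: ptensor x y) <= 1.
    move=> c1; apply: le_trans (f_le _) _.
    apply: le_trans (@atomic_gauge_le M _ [:: (c, (x, y))] M0 _) _.
      by rewrite /= x1 y1.
    by rewrite /cost /tensor_sum !big_seq1/= subrr normr0 mulr0 addr0.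
  rewrite ler_norml.
  have := F_le 1; have := F_le (-1); rewrite normrN normr1 scale1r scaleN1r linearN.
  by move=> /(_ (lexx _)) ? /(_ (lexx _)) ?; apply/andP; split; lra.
have [B0 B0E] : exists B : cbilinear X Y, forall x y, B x y = F (ptensor x y).
  apply: (@cbilinear_of_bounded _ _ _ _ M).
    split=> [y k x x'|x k y y'].
      by rewrite (ptensor_bilinear.1 y k) linearP.
    by rewrite (ptensor_bilinear.2 x k) linearP.
  move=> x y; apply: le_trans (FM _) _.
  by rewrite -mulrA ler_wpM2l// norm_ptensor_le.
have B01 : `|B0| <= 1.
  by apply: cbilinear_norm_le => x y x1 y1; rewrite B0E F1.
have F_sum l : F (tensor_sum l) = closed_span_val (tensor_sum l) B0.
  rewrite tensor_sumE /tensor_sum linear_sum.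
  by apply: eq_bigr => i _; rewrite linearZ B0E.
suff ftB : F t = closed_span_val t B0.
  rewrite -ft -[f t]/(F t) ftB (le_trans (ler_norm _))//.
  by rewrite (le_trans (proj_tensor_bound _ _))// ler_piMr.
(* F and the evaluation at B0 are M- and 1-Lipschitz, hence the tolerance *)
apply/subr0_eq/eqP; rewrite -normr_le0; apply/ler_addgt0Pr => e e0.
have M1 : 0 < M + 1 by lra.
have [l ul tl] := tensor_sum_dense t (divr_gt0 e0 M1).
have -> : F t - closed_span_val t B0 =
    F (t - tensor_sum l) - closed_span_val (t - tensor_sum l) B0.
  rewrite linearB -[closed_span_val (t - _) B0]/
    (closed_span_val t B0 - closed_span_val (tensor_sum l) B0) F_sum.
  by rewrite opprB addrA subrK.
rewrite add0r (le_trans (ler_normB _ _))//.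
have h1 := FM (t - tensor_sum l).
have h2 := proj_tensor_bound (t - tensor_sum l) B0.
have h3 : `|t - tensor_sum l| * `|B0| <= `|t - tensor_sum l| by rewrite ler_piMr.
have h4 : (M + 1) * `|t - tensor_sum l| <= e.
  by rewrite mulrC -ler_pdivlMr// ltW.
by lra.
Qed.

(** With [M] of the order of [1 / e], a nearly optimal list for the gauge has both a
cost close to the norm and a small error. The bound on the cost by the norm is what
density alone does not give. *)
Lemma atomic_approximation t (e : R) : 0 < e -> exists l,
  [/\ unit_atoms l, cost l <= `|t| + e & `|t - tensor_sum l| <= e].
Proof.
move=> e0; pose M := (`|t| + e) / e.
have te0 : 0 < `|t| + e by rewrite ltr_wpDl.
have M0 : 0 <= M by rewrite /M ltW// divr_gt0.
have hi : has_inf [set cost l + M * `|t - tensor_sum l| | l in unit_atoms].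
  split; first by exists (cost [::] + M * `|t - tensor_sum [::]|), [::].
  exists 0 => _ [s _ <-].
  by apply: addr_ge0; [exact: cost_ge0 | exact: mulr_ge0].
have [_ [l ul <-]] := inf_adherent e0 hi.
rewrite -/(atomic_gauge M t) => lM.
have {}lM : cost l + M * `|t - tensor_sum l| < `|t| + e.
  by apply: lt_le_trans lM _; rewrite lerD2r atomic_gauge_le_norm.
have c0 := cost_ge0 l.
exists l; split=> //.
  by apply: le_trans (ltW lM); rewrite lerDl mulr_ge0.
have : M * `|t - tensor_sum l| <= `|t| + e by lra.
by rewrite /M mulrAC ler_pdivrMr// ler_pM2l.
Qed.

End atoms.

(** Approximate [w], then the remainder, and so on, with errors [4^-1 ^+ k.+1]: the
list that is chosen at step [k] costs hardly more than the norm of the remainder, so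
the costs decay geometrically and the sum is absolutely convergent. *)
Lemma nuclear_representation (R : realType) (X Y : normedModType R)
    (w : proj_tensor X Y) : exists (s : nat -> seq (R * (X * Y))) (C : R),
  [/\ forall k, unit_atoms (s k),
      forall k, cost (s k) <= C * 4^-1 ^+ k &
      forall B : cbilinear X Y,
        \sum_(k < n) pairing (s k) B @[n --> \oo] --> closed_span_val w B].
Proof.
have q0 k : 0 < 4^-1 ^+ k :> R by rewrite exprn_gt0//; lra.
pose G (p : nat * proj_tensor X Y) (l : seq (R * (X * Y))) :=
  [/\ unit_atoms l, cost l <= `|p.2| + 4^-1 ^+ p.1.+1 &
      `|p.2 - tensor_sum l| <= 4^-1 ^+ p.1.+1].
have /choice[g gP] : forall p, exists l, G p l.
  by move=> [k t]; exact: atomic_approximation.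
pose r := fix r k := if k is j.+1 then r j - tensor_sum (g (j, r j)) else w.
pose s k := g (k, r k).
have r_sum n : \sum_(k < n) tensor_sum (s k) = w - r n.
  elim: n => [|n IH]; first by rewrite big_ord0 subrr.
  by rewrite big_ord_recr/= IH opprB addrA [in RHS]addrAC.
have r_small n : `|r n.+1| <= 4^-1 ^+ n.+1 by have [] := gP (n, r n).
exists s, (`|w| + 2); split=> [k|k|B].
- by have [] := gP (k, r k).
- have [_ /= sk _] := gP (k, r k); apply: le_trans sk _.
  rewrite exprS; case: k => [|k] /=; first by rewrite expr0; lra.
  have := r_small k; have := q0 k.+1; have := mulr_ge0 (normr_ge0 w) (ltW (q0 k.+1)).
  by rewrite /=; lra.
- have sumE n : \sum_(k < n) pairing (s k) B =
      closed_span_val w B - closed_span_val (r n) B.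
    transitivity (closed_span_val (\sum_(k < n) tensor_sum (s k)) B).
      elim: n => [|n IH]; first by rewrite !big_ord0.
      by rewrite !big_ord_recr/= IH -tensor_sumE.
    by rewrite r_sum.
  have rB0 : closed_span_val (r n) B @[n --> \oo] --> 0.
    apply/norm_cvg0P.
    apply: (@squeeze_cvgr _ _ _ _ (cst 0)
      (fun n => (`|w| + 1) * `|B| * 4^-1 ^+ n)); last 2 first.
    + exact: cvg_cst.
    + rewrite -(mulr0 ((`|w| + 1) * `|B|)).
      by apply: cvgM; [exact: cvg_cst|apply: cvg_expr; rewrite ger0_norm; lra].
    apply: nearW => n /=; rewrite normr_ge0/= (le_trans (proj_tensor_bound _ _))//.
    rewrite mulrAC ler_wpM2r//.
    case: n => [|n]; first by rewrite -[r 0]/w expr0; lra.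
    apply: le_trans (r_small n) _; rewrite ler_peMl ?(ltW (q0 _))//.
    by have := normr_ge0 w; lra.
  have := cvgB (cvg_cst (closed_span_val w B)) rB0.
  by rewrite subr0 (funext sumE); apply.
Qed.

(** * The approximation property *)

(** If [x] is not a cluster point of a filter on [K], the filter lives on a finite
subset of [K], and finite sets are compact. *)
Lemma compact_cofinite (T : topologicalType) (K : set T) (x : T) :
  K x -> (forall U, nbhs x U -> finite_set (K `\` U)) -> compact K.
Proof.
move=> Kx Kfin F FF FK.
have [Fx|] := pselect (cluster F x); first by exists x.
rewrite /cluster /meets => /existsNP[A] /existsNP[U].
move=> /not_implyP[FA /not_implyP[xU AU]].
have FKU : F (K `\` U).
  apply: filterS (filterI FK FA) => v [Kv Av]; split=> // Uv.
  by apply: AU; exists v.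
have [p [[Kp _] Fp]] := finite_compact (Kfin U xU) FF FKU.
by exists p.
Qed.

Lemma compact_null_union (R : realType) (V : normedModType R)
    (F : nat -> set V) :
    (forall k, finite_set (F k)) ->
    (forall k v, F k v -> `|v| <= 2^-1 ^+ k) ->
  compact ([set 0] `|` \bigcup_k F k).
Proof.
move=> Ffin Fle; apply: (@compact_cofinite _ _ 0); first by left.
move=> U /nbhs_norm0P[e /= e0 eU].
have : 2^-1 ^+ k @[k --> \oo] --> (0 : R).
  by apply: cvg_expr; rewrite ger0_norm; lra.
move=> /cvgr0_norm_lt/(_ e e0)[N _ NP].
apply: (@sub_finite_set _ _ (\bigcup_(k in `I_N) F k)); last first.
  by apply: bigcup_finite => //; exact: finite_II.
move=> v [[/= ->|[k _ Fkv]] Uv].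
  by case: Uv; apply: eU; rewrite /= normr0.
exists k => //=; rewrite ltnNge; apply/negP => Nk; apply: Uv; apply: eU => /=.
apply: le_lt_trans (Fle _ _ Fkv) _.
by have := NP k Nk; rewrite /= ger0_norm// exprn_ge0//; lra.
Qed.

(** The series is kept as data, with [W] the functional that it defines, so that the
argument applies verbatim after exchanging the two factors. *)
Section approximation.
Context {R : realType} {X Y : normedModType R}.
Variables (s : nat -> seq (R * (X * Y))) (C : R) (W : cbilinear X Y -> R).
Hypothesis s_unit : forall k, unit_atoms (s k).
Hypothesis s_cost : forall k, cost (s k) <= C * 4^-1 ^+ k.
Hypothesis sW : forall B : cbilinear X Y,
  \sum_(k < n) pairing (s k) B @[n --> \oo] --> W B.
Hypothesis W_rank1 : forall (f : dual X) (g : dual Y) (E : cbilinear X Y),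
  (forall x y, E x y = f x * g y) -> W E = 0.

Let WB (B E : cbilinear X Y) : W (B - E) = W B - W E.
Proof.
rewrite -(cvg_lim (@Rhausdorff R) (@sW (B - E))); apply: cvg_lim => //.
have -> : (fun n => \sum_(k < n) pairing (s k) (B - E)) =
    (fun n => \sum_(k < n) pairing (s k) B - \sum_(k < n) pairing (s k) E).
  apply/funext => n; rewrite -sumrB; apply: eq_bigr => k _.
  rewrite /pairing -sumrB; apply: eq_bigr => i _.
  by rewrite -mulrBr.
exact: cvgB (@sW B) (@sW E).
Qed.

Let W_finite_rank (B : cbilinear X Y) (l : seq (dual X * X)) (E : cbilinear X Y) :
  (forall x y, E x y = \sum_(i <- l) i.1 x * B i.2 y) -> W E = 0.
Proof.
elim: l E => [|[f v] l IH] E EE.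
  by apply: (W_rank1 (f := 0) (g := 0)) => x y; rewrite EE big_nil mulr0.
have [g gE] : exists g : dual Y, forall y, g y = B v y.
  apply: (@dual_of_bounded _ _ _ (`|B| * `|v|)).
    by move=> k y y'; rewrite linearPr.
  by move=> y; exact: cbilinear_le.
have [E1 E1E] : exists E1 : cbilinear X Y, forall x y, E1 x y = f x * g y.
  apply: (@cbilinear_of_bounded _ _ _ _ (`|f| * `|g|)).
    split=> [y k x x'|x k y y']; rewrite linearP/= /GRing.scale/=; ring.
  move=> x y; rewrite normrM mulrAC mulrAC -mulrA mulrACA.
  by rewrite ler_pM// dual_norm_bound.
have W1 : W E1 = 0 by exact: W_rank1 E1E.
suff: W (E - E1) = 0 by rewrite WB W1 subr0.
apply: IH => x y.
rewrite -[LHS]/(E x y - E1 x y) EE E1E gE big_cons/=.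
by rewrite addrAC subrr add0r.
Qed.

(** Split the costs [4^-1 ^+ k] evenly: the vectors [2^-1 ^+ k *: x] form, with 0, a
compact set, while the weights that remain, [2 ^+ k] times the costs, are still
summable. If [T] has finite rank and nearly fixes that compact set, then [W] kills
the form [B (T x) y], a finite sum of products of functionals, and is small on the
difference. *)
Lemma approximation_property_pairing_eq0 (B : cbilinear X Y) :
  approximation_property X -> W B = 0.
Proof.
move=> AP; have C0 : 0 <= C.
  by have := s_cost 0; rewrite expr0 mulr1; apply: le_trans; exact: cost_ge0.
have h0 k : 0 < 2^-1 ^+ k :> R by rewrite exprn_gt0//; lra.
pose F k := [set` [seq 2^-1 ^+ k *: i.2.1 | i <- s k]].
have Fcompact : compact ([set 0] `|` \bigcup_k F k).
  apply: compact_null_union => [k|k v /=]; first exact: finite_seq.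
  move=> /mapP[i /(allP (s_unit k))/andP[i1 _] ->].
  by rewrite normrZ gtr0_norm// ler_piMr// ltW.
apply/eqP; rewrite -normr_le0; apply/ler_addgt0Pr => e e0; rewrite add0r.
(* 2 C |B| bounds the total error for T within 1; adding 1 makes it invertible *)
pose D := 2 * C * `|B| + 1.
have D0 : 0 < D by rewrite /D ltr_wpDl// !mulr_ge0.
have [T [[M TM] [es Tes] TF]] := AP _ _ (divr_gt0 e0 D0) Fcompact.
have [||l TE] := @finite_rank_expansion _ _ _ es T M _ TM.
- by move=> k u v; rewrite linearP.
- move=> v; have [n [c [a [ae ->]]]] := Tes (T v) (imageT T v).
  exists n, c, a; split=> // i; have := ae i.
  by rewrite /= inE => ->; rewrite orbT.
have [E EE] : exists E : cbilinear X Y, forall x y, E x y = B (T x) y.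
  apply: (@cbilinear_of_bounded _ _ _ _ (`|B| * M)).
    by split=> [y k x x'|x k y y']; rewrite ?linearP ?linearPl ?linearPr.
  move=> x y; apply: le_trans (cbilinear_le B _ _) _.
  by rewrite ler_wpM2r// -mulrA ler_wpM2l//.
have WE : W E = 0.
  apply: (@W_finite_rank B l) => x y; rewrite EE TE linear_sumlz.
  by apply: eq_bigr => i _; rewrite linearZl_LR.
have -> : W B = W (B - E) by rewrite WB WE subr0.
(* the k-th list costs at most C / 4^k and T moves its vectors by at most 2^k e / D *)
have k_le k : `|pairing (s k) (B - E)| <= C * `|B| * (e / D) * 2^-1 ^+ k.
  rewrite /pairing (le_trans (ler_norm_sum _ _ _))//.
  apply: (@le_trans _ _ (cost (s k) * (`|B| * (e / D / 2^-1 ^+ k)))).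
    rewrite /cost mulr_suml big_seq [leRHS]big_seq ler_sum// => i si.
    rewrite normrM ler_wpM2l//.
    have -> : (B - E) i.2.1 i.2.2 = B (i.2.1 - T i.2.1) i.2.2.
      by rewrite -[LHS]/(B _ _ - E _ _) EE linearBl.
    apply: le_trans (cbilinear_le B _ _) _; rewrite -mulrA ler_wpM2l//.
    have /andP[_ i2] := allP (s_unit k) _ si.
    apply: (@le_trans _ _ `|i.2.1 - T i.2.1|); first by rewrite ler_piMr.
    rewrite ler_pdivlMr// -[2^-1 ^+ k]gtr0_norm// mulrC -normrZ scalerBr.
    rewrite -[X in _ - X]linearZ.
    rewrite distrC; apply: TF; right; exists k => //=.
    exact: map_f.
  apply: (@le_trans _ _ (C * 4^-1 ^+ k * (`|B| * (e / D / 2^-1 ^+ k)))).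
    by rewrite ler_wpM2r// mulr_ge0// divr_ge0 ?divr_ge0// ltW.
  have -> : 4^-1 = 2^-1 * 2^-1 :> R by lra.
  rewrite exprMn le_eqVlt; apply/orP; left; apply/eqP; field.
  by rewrite !gt_eqF.
have lim_norm : `|\sum_(k < n) pairing (s k) (B - E)| @[n --> \oo] -->
  `|W (B - E)| by exact: cvg_norm (@sW (B - E)).
apply: (cvgr_to_le lim_norm).
apply: nearW => n; apply: le_trans (ler_norm_sum _ _ _) _.
apply: (@le_trans _ _ (\sum_(k < n) C * `|B| * (e / D) * 2^-1 ^+ k)).
  by apply: ler_sum => k _; exact: k_le.
rewrite -mulr_sumr.
have sum_le : \sum_(k < n) 2^-1 ^+ k <= 2 :> R.
  have : \sum_(k < n) 2^-1 ^+ k = 2 - 2 * 2^-1 ^+ n :> R.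
    elim: (n : nat) => [|m IH]; first by rewrite big_ord0 expr0; lra.
    by rewrite big_ord_recr/= IH exprS; lra.
  by have := h0 n; lra.
apply: (@le_trans _ _ (C * `|B| * (e / D) * 2)).
  rewrite ler_wpM2l//; apply: mulr_ge0; first exact: mulr_ge0.
  exact/ltW/divr_gt0.
have -> : C * `|B| * (e / D) * 2 = (2 * C * `|B|) * e / D by ring.
by rewrite ler_pdivrMr// mulrC ler_wpM2l ?(ltW e0)// /D lerDl.
Qed.

End approximation.

(** The role of the approximation property: it lets products of functionals
separate the points of the projective tensor product. When it holds for [Y], the
series is transposed and the previous argument is applied to [Y] and [X]. *)
Lemma proj_tensor_eq0 (R : realType) (X Y : normedModType R)
    (w : proj_tensor X Y) :
    approximation_property X \/ approximation_property Y ->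
    (forall (f : dual X) (g : dual Y) (E : cbilinear X Y),
       (forall x y, E x y = f x * g y) -> closed_span_val w E = 0) ->
  w = 0.
Proof.
have [s [C [s_unit s_cost sw]]] := nuclear_representation w.
move=> AP w_rank1; apply: proj_tensorP => B; case: AP => [XAP|YAP].
  exact: (approximation_property_pairing_eq0 s_unit s_cost sw w_rank1 B XAP).
have transpose (U V : normedModType R) (D : cbilinear U V) :
    exists E : cbilinear V U, forall v u, E v u = D u v.
  apply: (@cbilinear_of_bounded _ _ _ _ `|D|).
    by split=> [u k v v'|v k u u']; rewrite ?linearPl ?linearPr.
  by move=> v u; rewrite mulrAC; exact: cbilinear_le.
have /choice[tr trE] := transpose Y X.
pose swap (l : seq (R * (X * Y))) := [seq (i.1, (i.2.2, i.2.1)) | i <- l].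
have [D DB] := transpose _ _ B.
have -> : B = tr D.
  by apply: val_inj; do 2 (apply/funext => ?); rewrite /= trE DB.
apply: (@approximation_property_pairing_eq0 _ _ _ (swap \o s) C
  (fun D => closed_span_val w (tr D))) YAP.
- move=> k; rewrite /unit_atoms all_map; apply: sub_all (s_unit k) => i /=.
  by rewrite andbC.
- by move=> k; rewrite /cost big_map; exact: s_cost.
- move=> D'; have -> : (fun n => \sum_(k < n) pairing ((swap \o s) k) D') =
      (fun n => \sum_(k < n) pairing (s k) (tr D')); last exact: sw.
  apply/funext => n; apply: eq_bigr => k _; rewrite /pairing big_map.
  by apply: eq_bigr => i _; rewrite trE.
- move=> f g E EE; apply: (w_rank1 g f) => x y.
  by rewrite trE EE mulrC.
Qed.

Theorem corollary1p3 (R : realType) (X Y : completeNormedModType R)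
    (hAP : approximation_property X \/ approximation_property Y)
    (xs : nat -> X) (x : X) (ys : nat -> Y) (y : Y)
    (hx : weakly_cvg xs x) (hy : weakly_cvg ys y)
    (hxy : exists u : proj_tensor X Y,
       weakly_cvg (fun n => ptensor (xs n) (ys n)) u) :
  weakly_cvg (fun n => ptensor (xs n) (ys n)) (ptensor x y).
Proof.
have [u hu] := hxy; suff <- : u = ptensor x y by [].
apply/subr0_eq; apply: proj_tensor_eq0 hAP _ => f g E EE.
have [ev evE] : exists ev : dual (proj_tensor X Y),
    forall t, ev t = closed_span_val t E.
  apply: (@dual_of_bounded _ _ _ `|E|) => // t.
  by rewrite mulrC; exact: proj_tensor_bound.
apply/eqP; rewrite -[X in X == _]/(closed_span_val u E - E x y) subr_eq0.
rewrite -evE EE; apply/eqP.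
rewrite -(cvg_lim (@Rhausdorff R) (hu ev)); apply: cvg_lim => //.
have -> : (fun n => ev (ptensor (xs n) (ys n))) = (fun n => f (xs n) * g (ys n)).
  by apply/funext => n; rewrite evE ptensorE EE.
exact: cvgM (hx f) (hy g).
Qed.
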